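(* For every $N \in \mathbb{N}$ there exists a right-angled Artin group $A_\Gamma$ such that $|\mathrm{Out}(\mathrm{Out}(A_\Gamma))| > N$.
   Context: For a finite simplicial graph $\Gamma=(V,E)$, the right-angled Artin group $A_\Gamma$ is the group with presentation $\langle v\in V \mid [v,w]=1 \text{ whenever } (v,w)\in E\rangle$. For a group $G$, $\mathrm{Out}(G)=\mathrm{Aut}(G)/\mathrm{Inn}(G)$. *)

(* Defs.v *)
(* Groups are presented as setoid-style data:
   a carrier type, a domain predicate (the elements that belong to the group),
   an equality relation (equality in the group), multiplication, inverse, unit. *)
From mathcomp Require Import all_boot.

Record grp := Grp {
  car  : Type;
  gdom : car -> Prop;
  geq  : car -> car -> Prop;
  gmul : car -> car -> car;
  ginv : car -> car;
  gone : car }.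

Set Implicit Arguments. Unset Strict Implicit. Unset Printing Implicit Defensive.

Definition simplicial (V : finType) (E : rel V) : Prop :=
  (forall x, ~~ E x x) /\ (forall x y, E x y = E y x).

(* words in the generators and their inverses: (v, false) = v, (v, true) = v^-1 *)
Definition word (V : finType) := seq (V * bool).

Definition winv (V : finType) (w : word V) : word V :=
  rev (map (fun p => (p.1, ~~ p.2)) w).

(* the congruence on words defining <V | [v,w] = 1 for (v,w) in E> :
   free reduction plus commutation of adjacent generators *)
Inductive raag_eq (V : finType) (E : rel V) : word V -> word V -> Prop :=
  | re_refl w : raag_eq E w w
  | re_sym u v : raag_eq E u v -> raag_eq E v u
  | re_trans u v w : raag_eq E u v -> raag_eq E v w -> raag_eq E u w
  | re_cancel u v x b : raag_eq E (u ++ (x, b) :: (x, ~~ b) :: v) (u ++ v)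
  | re_comm u v x y : E x y ->
      raag_eq E (u ++ (x, false) :: (y, false) :: v)
                (u ++ (y, false) :: (x, false) :: v).

Definition RAAG (V : finType) (E : rel V) : grp :=
  @Grp (word V) (fun _ => True) (@raag_eq V E) (@cat _) (@winv V) [::].

Definition is_aut (G : grp) (fg : (car G -> car G) * (car G -> car G)) : Prop :=
  let f := fg.1 in let g := fg.2 in
  (forall x, gdom G x -> gdom G (f x)) /\
  (forall x, gdom G x -> gdom G (g x)) /\
  (forall x y, gdom G x -> gdom G y -> geq G x y -> geq G (f x) (f y)) /\
  (forall x y, gdom G x -> gdom G y -> geq G x y -> geq G (g x) (g y)) /\
  (forall x y, gdom G x -> gdom G y ->
      geq G (f (gmul G x y)) (gmul G (f x) (f y))) /\
  (forall x, gdom G x -> geq G (f (g x)) x) /\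
  (forall x, gdom G x -> geq G (g (f x)) x).

Definition Out (G : grp) : grp :=
  @Grp ((car G -> car G) * (car G -> car G))
    (@is_aut G)
    (fun a b => exists h, gdom G h /\
        forall x, gdom G x ->
          geq G (a.1 x) (gmul G (gmul G h (b.1 x)) (ginv G h)))
    (fun a b => ((fun x => a.1 (b.1 x)), (fun x => b.2 (a.2 x))))
    (fun a => (a.2, a.1))
    ((fun x => x), (fun x => x)).

Definition card_gt (G : grp) (N : nat) : Prop :=
  exists s : 'I_N.+1 -> car G,
    (forall i, gdom G (s i)) /\ (forall i j, i != j -> ~ geq G (s i) (s j)).

(* Main.v *)
(* Let A be the right-angled Artin group of a cone with apex c over a graph with no further cone
   vertex. Its centre is <c>, so an automorphism f satisfies f c = c^eps with eps = 1 or -1. Let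
   e : A -> Z be a homomorphism with e c = 0 whose reduction mod 2 is invariant under Aut(A). The
   half transvection v |-> v c^(e v / 2) makes sense after adjoining a square root of c, and
   conjugation by it maps f to x |-> f x c^((e (f x) - eps e x) / 2), which is again an
   automorphism of A. This defines an automorphism of Out(A); those coming from e and e' differ
   by an inner one only if e = e' mod 2.

   Invariant classes come from the cup product on H^1(A; F_2), whose elements are sets S of
   vertices: counting the classes orthogonal to S, the base graph being a disjoint union of cubes
   of various dimensions, singles out the vertices of degree d, whose sum is therefore
   invariant. *)
Require Import Defs.
From HB Require Import structures.
From Stdlib Require Import Setoid Morphisms.
From mathcomp Require Import all_boot all_algebra zify ring.

Set Implicit Arguments. Unset Strict Implicit. Unset Printing Implicit Defensive.
Import GRing.Theory.

(** * The congruence on words *)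

#[export] Instance raag_eq_equiv (V : finType) (E : rel V) : Equivalence (raag_eq E).
Proof.
by split; [exact: re_refl | move=> u v; exact: re_sym | move=> u v w; exact: re_trans].
Qed.

#[local] Hint Resolve re_refl : core.

Lemma raag_eq_ctx (V : finType) (E : rel V) (a b u v : word V) :
  raag_eq E u v -> raag_eq E (a ++ u ++ b) (a ++ v ++ b).
Proof.
elim=> {u v} [w|u v _ IH|u v w _ IH1 _ IH2|u v x c|u v x y Exy].
- exact: re_refl.
- exact: re_sym.
- exact: re_trans IH1 IH2.
- by rewrite -!catA /= 2!(catA a u); apply: re_cancel.
- by rewrite -!catA /= 2!(catA a u); apply: re_comm.
Qed.

#[export] Instance raag_eq_cat (V : finType) (E : rel V) :
  Proper (raag_eq E ==> raag_eq E ==> raag_eq E) cat.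
Proof.
move=> u u' uu' v v' vv'; apply: (@re_trans _ _ _ (u' ++ v)).
  exact: (raag_eq_ctx [::] v uu').
by have := raag_eq_ctx u' [::] vv'; rewrite !cats0.
Qed.

Section Words.
Variables (V : finType) (E : rel V).
Local Notation "u ≈ v" := (raag_eq E u v) (at level 70).
Implicit Types u v w : word V.

Lemma winv_cons p w : winv (p :: w) = winv w ++ [:: (p.1, ~~ p.2)].
Proof. by rewrite /winv /= rev_cons cats1. Qed.

Lemma cat_letterV x b : [:: (x, b)] ++ [:: (x, ~~ b)] ≈ [::].
Proof. exact: (@re_cancel V E [::] [::] x b). Qed.

Lemma cat_winv w : w ++ winv w ≈ [::].
Proof.
elim: w => [|[x b] w IH]; first reflexivity.
rewrite winv_cons -cat1s -!catA (catA w) /=.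
change ([:: (x, b)] ++ ((w ++ winv w) ++ [:: (x, ~~ b)]) ≈ [::]).
by rewrite IH; apply: cat_letterV.
Qed.

Lemma winv_cat w : winv w ++ w ≈ [::].
Proof.
elim: w => [|[x b] w IH]; first reflexivity.
rewrite winv_cons -cat1s -!catA /=.
change (winv w ++ [:: (x, ~~ b)] ++ [:: (x, b)] ++ w ≈ [::]).
by rewrite (catA [:: (x, ~~ b)]) -{2}(negbK b) cat_letterV; apply: IH.
Qed.

Lemma cat_raag_eqI u v w : u ++ v ≈ u ++ w -> v ≈ w.
Proof.
move=> H; have : winv u ++ u ++ v ≈ winv u ++ u ++ w by rewrite H.
by rewrite !catA winv_cat.
Qed.

Lemma raag_eq_catI u v w : v ++ u ≈ w ++ u -> v ≈ w.
Proof.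
move=> H; have : (v ++ u) ++ winv u ≈ (w ++ u) ++ winv u by rewrite H.
by rewrite -!catA cat_winv !cats0.
Qed.

Lemma commute_letterV u x b :
  u ++ [:: (x, b)] ≈ [:: (x, b)] ++ u -> u ++ [:: (x, ~~ b)] ≈ [:: (x, ~~ b)] ++ u.
Proof.
move=> H; apply: (@cat_raag_eqI [:: (x, b)]); rewrite !catA cat_letterV -H -!catA.
by rewrite cat_letterV cats0.
Qed.

Lemma commute_edge x y a b : E x y -> [:: (x, a)] ++ [:: (y, b)] ≈ [:: (y, b)] ++ [:: (x, a)].
Proof.
move=> Exy.
have H : [:: (x, false)] ++ [:: (y, false)] ≈ [:: (y, false)] ++ [:: (x, false)].
  exact: (@re_comm V E [::] [::] x y Exy).
have Hb : [:: (x, false)] ++ [:: (y, b)] ≈ [:: (y, b)] ++ [:: (x, false)].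
  by case: b => //; apply: (commute_letterV H).
by case: a => //; symmetry; apply: (@commute_letterV _ x false); symmetry.
Qed.

(** Universal property of the presentation, with a monoid as target; it is applied to the integers,
    to F_2 and to the Heisenberg group. *)
Lemma eval_raag_eq (T : Type) (idx : T) (op : Monoid.law idx) (l : V * bool -> T) :
  (forall x b, op (l (x, b)) (l (x, ~~ b)) = idx) ->
  (forall x y, E x y -> op (l (x, false)) (l (y, false)) = op (l (y, false)) (l (x, false))) ->
  forall u v, u ≈ v -> \big[op/idx]_(p <- u) l p = \big[op/idx]_(p <- v) l p.
Proof.
move=> HV HE u v; elim=> {u v} [//|u v _ ->//|u v w _ -> _ -> //|u v x b|u v x y Exy].
- rewrite !big_cat !big_cons /=; congr (op _ _); rewrite -[RHS](Monoid.mul1m op).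
  by apply: etrans (Monoid.mulmA op _ _ _) _; congr (op _ _); apply: HV.
- rewrite !big_cat !big_cons /=; congr (op _ _).
  apply: etrans (Monoid.mulmA op _ _ _) _; apply/esym/(etrans (Monoid.mulmA op _ _ _)).
  by congr (op _ _); apply/esym/HE.
Qed.

End Words.

(** * Reduced words and central elements *)

Section Piles.
Variables (V : finType) (E : rel V).
Hypotheses (Eirr : forall x, ~~ E x x) (Esym : forall x y, E x y = E y x).
Local Notation "u ≈ v" := (raag_eq E u v) (at level 70).

(* Crisp, Godelle and Wiest's piles: a letter [(x, b)] is put on the stack of [x], and a marker
   [None] on the stack of every other vertex not adjacent to [x]. *)
Definition pile := {ffun V -> seq (option bool)}.
Implicit Types (p q : pile) (u v w t : word V).

Definition ptop p x : option (option bool) := ohead (p x).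

Definition push (l : V * bool) p : pile :=
  [ffun v => if E l.1 v then p v else (if v == l.1 then Some l.2 else None) :: p v].

Definition pop (x : V) p : pile := [ffun v => if E x v then p v else behead (p v)].

Definition step p (l : V * bool) : pile :=
  if ptop p l.1 == Some (Some (~~ l.2)) then pop l.1 p else push l p.

Definition piles w : pile := foldl step [ffun => [::]] w.

(** Piles built without cancellation. In an arbitrary family of stacks, a letter on top need not
    come with the markers that [pop] removes from the other stacks. *)
Inductive valid : pile -> Prop :=
| valid0 : valid [ffun => [::]]
| valid_push p x b : valid p -> ptop p x != Some (Some (~~ b)) -> valid (push (x, b) p).

Lemma ptop_push_self x b p : ptop (push (x, b) p) x = Some (Some b).
Proof. by rewrite /ptop ffunE /= (negbTE (Eirr x)) eqxx. Qed.

Lemma ptop_push_adj x b p y : E x y -> ptop (push (x, b) p) y = ptop p y.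
Proof. by move=> Exy; rewrite /ptop ffunE /= Exy. Qed.

Lemma ptop_push_nadj x b p y : y != x -> ~~ E x y -> ptop (push (x, b) p) y = Some None.
Proof. by move=> nyx nE; rewrite /ptop ffunE /= (negbTE nE) (negbTE nyx). Qed.

Lemma pop_push x b p : pop x (push (x, b) p) = p.
Proof. by apply/ffunP=> v; rewrite !ffunE /=; case: (E x v). Qed.

Lemma pushC x a y b p : E x y -> push (x, a) (push (y, b) p) = push (y, b) (push (x, a) p).
Proof.
move=> Exy; apply/ffunP=> v; rewrite !ffunE /=.
case Exv: (E x v); case Eyv: (E y v) => //.
case: eqP => [vx|_]; first by move: Eyv; rewrite vx Esym Exy.
case: eqP => [vy|_] //; by move: Exv; rewrite vy Exy.
Qed.

(* The top letter of a pile can be moved past all letters pushed after it. *)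
Lemma valid_top p x b : valid p -> ptop p x = Some (Some b) ->
  exists q, [/\ valid q, ptop q x != Some (Some (~~ b)) & p = push (x, b) q].
Proof.
elim=> [|q y d vq IH qy]; first by rewrite /ptop ffunE.
have [<-|nxy] := eqVneq y x.
  by rewrite ptop_push_self => -[<-]; exists q.
case Eyx: (E y x); last by rewrite ptop_push_nadj ?Eyx 1?eq_sym.
rewrite ptop_push_adj // => /IH [r [vr rx eq]]; subst q.
have Exy : E x y by rewrite Esym.
exists (push (y, d) r); split.
- by apply: valid_push => //; rewrite ptop_push_adj in qy.
- by rewrite ptop_push_adj.
- by rewrite pushC.
Qed.

Lemma step_valid p l : valid p -> valid (step p l).
Proof.
case: l => x b vp; rewrite /step /=; case: ifPn => [/eqP|/(valid_push vp)//].
by case/(valid_top vp) => q [vq _ ->]; rewrite pop_push.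
Qed.

Lemma step_push p x b : ptop p x != Some (Some (~~ b)) -> step p (x, b) = push (x, b) p.
Proof. by rewrite /step /= => /negbTE->. Qed.

Lemma step_pop p x b : step (push (x, b) p) (x, ~~ b) = p.
Proof. by rewrite /step /= ptop_push_self negbK eqxx pop_push. Qed.

Lemma step_popV p x b : step (push (x, ~~ b) p) (x, b) = p.
Proof. by rewrite -{2}[b]negbK step_pop. Qed.

Lemma stepV p x b : valid p -> step (step p (x, b)) (x, ~~ b) = p.
Proof.
move=> vp; have [/eqP|h] := boolP (ptop p x == Some (Some (~~ b))); last first.
  by rewrite (step_push h) step_pop.
case/(valid_top vp) => q [vq hq ->].
by rewrite step_popV step_push.
Qed.

Lemma step_pushC q x a y b : valid q -> E x y ->
  step (push (y, b) q) (x, a) = push (y, b) (step q (x, a)).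
Proof.
move=> vq Exy; have Eyx : E y x by rewrite Esym.
have [/eqP|h] := boolP (ptop q x == Some (Some (~~ a))); last first.
  by rewrite !step_push ?ptop_push_adj // pushC.
case/(valid_top vq) => r [vr hr ->].
by rewrite -pushC // !step_popV.
Qed.

Lemma stepC p x a y b : valid p -> E x y ->
  step (step p (x, a)) (y, b) = step (step p (y, b)) (x, a).
Proof.
move=> vp Exy; have Eyx : E y x by rewrite Esym.
have [/eqP|hy] := boolP (ptop p y == Some (Some (~~ b))).
  case/(valid_top vp) => q [vq hq ->].
  by rewrite step_pushC // !step_popV.
by rewrite [step p (y, b)]step_push // step_pushC // step_push // /step /=;
  case: ifP => _; rewrite /ptop ffunE /= Exy.
Qed.

Lemma foldl_step_valid p w : valid p -> valid (foldl step p w).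
Proof. by elim: w p => //= l w IH p vp; apply/IH/step_valid. Qed.

Lemma piles_valid w : valid (piles w).
Proof. by apply: foldl_step_valid; apply: valid0. Qed.

(** Each defining relation leaves the resulting pile unchanged, so the pile of a word depends only
    on the group element. *)
Lemma foldl_step_eq u v p : u ≈ v -> valid p -> foldl step p u = foldl step p v.
Proof.
move=> H; elim: H p => {u v} [//|u v _ IH p vp|u v w _ IH1 _ IH2 p vp|u v x b p vp|u v x y Exy p vp].
- by rewrite IH.
- by rewrite IH1 // IH2.
- by rewrite !foldl_cat /= stepV //; apply: foldl_step_valid.
- by rewrite !foldl_cat /= stepC //; apply: foldl_step_valid.
Qed.

Lemma piles_eq u v : u ≈ v -> piles u = piles v.
Proof. by move=> H; apply: foldl_step_eq H valid0. Qed.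

Lemma piles_rcons w l : piles (rcons w l) = step (piles w) l.
Proof. by rewrite /piles foldl_rcons. Qed.

Definition psize p : nat := \sum_x count isSome (p x).

Lemma psize_push l p : psize (push l p) = (psize p).+1.
Proof.
case: l => x b; rewrite /psize (bigD1 x) //= [X in _ = X.+1](bigD1 x) //= ffunE /=.
rewrite (negbTE (Eirr x)) eqxx /= add1n addSn; congr _.+1; congr addn.
by apply: eq_bigr => v nvx; rewrite ffunE /= (negbTE nvx); case: ifP.
Qed.

Lemma psize_step p x b : valid p ->
  psize (step p (x, b)) = if ptop p x == Some (Some (~~ b)) then (psize p).-1 else (psize p).+1.
Proof.
move=> vp; rewrite {1}/step /=; case: ifPn => [/eqP|_]; last by rewrite psize_push.
by case/(valid_top vp) => q [_ _ ->]; rewrite pop_push psize_push.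
Qed.

(** Markers do not count in [psize], so equality says that no letter of [w] cancels while its pile
    is built. *)
Definition reduced w := psize (piles w) == size w.

Lemma psize_piles w : psize (piles w) <= size w.
Proof.
elim/last_ind: w => [|w [x b] IH]; first by rewrite /psize big1 // => v _; rewrite ffunE.
rewrite piles_rcons size_rcons psize_step; last exact: piles_valid.
by case: ifP => _; lia.
Qed.

Lemma reduced_rcons w x b : reduced (rcons w (x, b)) =
  reduced w && (ptop (piles w) x != Some (Some (~~ b))).
Proof.
rewrite /reduced piles_rcons size_rcons psize_step; last exact: piles_valid.
have := psize_piles w; case: ifP => _ h; rewrite ?andbT ?andbF //.
by apply/negbTE; lia.
Qed.

(** A letter still on top of its stack was followed only by adjacent vertices, so it commutes to the
    end of the word. *)
Lemma reduced_top w x b : reduced w -> ptop (piles w) x = Some (Some b) ->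
  exists t, w ≈ rcons t (x, b) /\ (size t).+1 = size w.
Proof.
elim/last_ind: w => [|w [y d] IH]; first by rewrite /ptop ffunE.
rewrite reduced_rcons piles_rcons => /andP[rw hy]; rewrite step_push //.
have [<-|nyx] := eqVneq y x.
  by rewrite ptop_push_self => -[<-]; exists w; rewrite size_rcons; split=> //; reflexivity.
case Eyx: (E y x); last by rewrite ptop_push_nadj ?Eyx 1?eq_sym.
rewrite ptop_push_adj // => /(IH rw) [t [wt st]].
exists (rcons t (y, d)); rewrite !size_rcons st; split=> //.
rewrite -!cats1 wt -cats1 -!catA; apply: raag_eq_cat; first reflexivity.
by apply: commute_edge; rewrite Esym.
Qed.

Lemma reduced_exists w : exists2 w', w ≈ w' & reduced w'.
Proof.
elim/last_ind: w => [|w [x b] [u wu ru]].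
  by exists [::]; rewrite // /reduced -leqn0 psize_piles.
have [/eqP h|h] := boolP (ptop (piles u) x == Some (Some (~~ b))); last first.
  by exists (rcons u (x, b)); rewrite ?reduced_rcons ?ru // -!cats1 wu; reflexivity.
have [t [ut st]] := reduced_top ru h.
have E1 : u ++ [:: (x, b)] ≈ t.
  by rewrite ut -cats1 -catA -{2}(negbK b) cat_letterV cats0; reflexivity.
exists t; first by rewrite -cats1 wu.
have := psize_piles t; rewrite -(piles_eq E1) cats1 piles_rcons psize_step; last exact: piles_valid.
by rewrite h eqxx /reduced -(piles_eq E1) cats1 piles_rcons psize_step ?h ?eqxx //;
  [rewrite (eqP ru) -st | exact: piles_valid].
Qed.

Definition central z := forall x, z ++ [:: (x, false)] ≈ [:: (x, false)] ++ z.

Lemma central_letter z x b : central z -> z ++ [:: (x, b)] ≈ [:: (x, b)] ++ z.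
Proof. by move=> /(_ x); case: b => // /commute_letterV. Qed.

(** If [v] were not adjacent to [y], pushing [v] after [z] would leave a marker on the stack of [y].
    But [v z], equal to [z v] in the group, is reduced and ends in [y], so it has that letter on
    top. *)
Lemma reduced_central_last t (y : V) b (v : V) : reduced (rcons t (y, b)) ->
  central (rcons t (y, b)) -> v != y -> E y v.
Proof.
set z := rcons t (y, b) => rz cz nvy; apply/negPn/negP => nE.
have pz : piles z = push (y, b) (piles t).
  by move: rz; rewrite reduced_rcons piles_rcons => /andP[_ h]; rewrite step_push.
have tv : ptop (piles z) v != Some (Some true) by rewrite pz ptop_push_nadj.
have pzv : piles (rcons z (v, false)) = push (v, false) (piles z).
  by rewrite piles_rcons step_push.
have pvz : piles ((v, false) :: z) = push (v, false) (piles z).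
  by rewrite -pzv; apply: piles_eq; symmetry; rewrite -cats1; apply: cz.
have rvz : reduced (rcons ((v, false) :: t) (y, b)).
  by rewrite /reduced rcons_cons pvz psize_push /= (eqP rz).
have : ptop (piles ((v, false) :: z)) y = Some (Some b).
  move: rvz; rewrite reduced_rcons => /andP[_ h].
  by rewrite /z -rcons_cons piles_rcons step_push // ptop_push_self.
by rewrite pvz ptop_push_nadj // 1?eq_sym // Esym.
Qed.

Lemma central_cat z w : central z -> z ++ w ≈ w ++ z.
Proof.
move=> cz; elim: w => [|[x b] w IH]; first by rewrite cats0.
by rewrite -cat1s catA (central_letter _ _ cz) -catA IH catA.
Qed.

Lemma central_catl z z' : central z -> central z' -> central (z ++ z').
Proof. by move=> cz cz' x; rewrite -catA (cz' x) catA (cz x) catA. Qed.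

Lemma central_eq z z' : z ≈ z' -> central z -> central z'.
Proof. by move=> zz' cz x; rewrite -zz'. Qed.

End Piles.

(** * Exponent sums and the centre of a cone *)

Section Exponent.
Variables (V : finType) (E : rel V).
Local Notation "u ≈ v" := (raag_eq E u v) (at level 70).
Local Open Scope ring_scope.

Definition sgb (b : bool) : int := if b then -1 else 1.

Definition exps (phi : V -> int) (w : word V) : int := \sum_(p <- w) sgb p.2 * phi p.1.

Lemma ex_nil phi : exps phi [::] = 0. Proof. exact: big_nil. Qed.

Lemma ex1 phi x b : exps phi [:: (x, b)] = sgb b * phi x.
Proof. exact: big_seq1. Qed.

Lemma ex_cat phi u v : exps phi (u ++ v) = exps phi u + exps phi v.
Proof. exact: big_cat. Qed.

Lemma ex_eq phi u v : u ≈ v -> exps phi u = exps phi v.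
Proof.
apply: eval_raag_eq => [x b|x y _] /=; last exact: addrC.
by case: b; rewrite /sgb /= !mulN1r !mul1r ?subrr // addNr.
Qed.

Lemma ex_opp phi w : exps (fun x => - phi x) w = - exps phi w.
Proof. by rewrite /exps -sumrN; apply: eq_bigr => p _; rewrite mulrN. Qed.

End Exponent.

Section Cone.
Variables (V : finType) (E : rel V) (c : V).
Hypotheses (Eirr : forall x, ~~ E x x) (Esym : forall x y, E x y = E y x).
Hypothesis Ec : forall v, v != c -> E c v.
Hypothesis Enc : forall v, v != c -> exists2 w, w != v & ~~ E v w.
Local Notation "u ≈ v" := (raag_eq E u v) (at level 70).
Local Open Scope ring_scope.

Definition cpow (k : int) : word V := nseq `|k| (c, k < 0).

Lemma cpowS k : cpow k ++ [:: (c, false)] ≈ cpow (k + 1).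
Proof.
case: k => n.
  by rewrite -PoszD /cpow /= nseqD.
rewrite (_ : Negz n + 1 = - n%:Z); last by lia.
rewrite (_ : cpow (Negz n) = nseq n (c, true) ++ [:: (c, true)]); last first.
  by rewrite -[RHS](nseqD n 1) addn1.
rewrite -catA -[false]/(~~ true) cat_letterV cats0.
by case: n => [|n] //; rewrite /cpow abszN.
Qed.

Lemma cpow_letter k b : cpow k ++ [:: (c, b)] ≈ cpow (k + sgb b).
Proof.
case: b; last exact: cpowS.
by rewrite -{1}(subrK 1 k) -cpowS -catA -[true]/(~~ false) cat_letterV cats0.
Qed.

Lemma cpow1 b : cpow (sgb b) = [:: (c, b)]. Proof. by case: b. Qed.

Lemma cpowD k l : cpow (k + l) ≈ cpow k ++ cpow l.
Proof.
elim/int_rec: l => [|n IH|n IH]; first by rewrite addr0 cats0.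
- by rewrite -addn1 PoszD addrA -!cpowS IH -catA.
- rewrite (_ : - n.+1%:Z = - n%:Z + sgb true); last by rewrite /sgb; lia.
  by rewrite addrA -!cpow_letter IH -catA.
Qed.

Lemma c_central : central E [:: (c, false)].
Proof. by move=> x; have [->//|nxc] := eqVneq x c; apply/commute_edge/Ec. Qed.

Lemma cpow_central k : central E (cpow k).
Proof.
have cl b : central E [:: (c, b)].
  case: b; [move=> x | exact: c_central].
  by symmetry; apply: (@commute_letterV _ _ _ _ false); symmetry; apply: c_central.
by rewrite /cpow; elim: `|k|%N => [|n IH] //; rewrite -[nseq _ _]cat1s; apply: central_catl.
Qed.

Lemma cpowC k w : cpow k ++ w ≈ w ++ cpow k.
Proof. exact/central_cat/cpow_central. Qed.

(** The last letter of a reduced central word is adjacent to all other vertices, so it is [c];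
    stripping it leaves a shorter reduced central word. *)
Lemma center_cone z : central E z -> exists k, z ≈ cpow k.
Proof.
have [w zw] := reduced_exists Eirr Esym z; move=> rw /(central_eq zw) cw.
suff [k wk] : exists k, w ≈ cpow k by exists k; rewrite zw.
elim/last_ind: w {zw} rw cw => [|t [y b] IH] rw cw; first by exists 0.
have yc : y = c.
  apply/eqP/negPn/negP => /Enc [v nvy]; apply/negP/negPn.
  exact: (reduced_central_last Eirr Esym rw cw).
subst y; move: (rw); rewrite reduced_rcons // => /andP[rt _].
have ct : central E t.
  apply: central_eq (central_catl cw (cpow_central (sgb (~~ b)))).
  by rewrite cpow1 -cats1 -catA cat_letterV cats0.
have [k tk] := IH rt ct.
by exists (k + sgb b); rewrite -cpow_letter -cats1 tk.
Qed.

Definition cexp : word V -> int := exps (fun x => (x == c)%:R).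

Lemma ex_cpow phi k : exps phi (cpow k) = k * phi c.
Proof.
have -> : exps phi (cpow k) = \sum_(i < `|k|) sgb (k < 0) * phi c.
  by rewrite /exps /cpow; elim: `|k|%N => [|n IH]; rewrite ?big_nil ?big_ord0 // big_cons big_ord_recl IH.
rewrite sumr_const card_ord -mulrnAl; congr (_ * _).
by case: k => n; rewrite /sgb /=; lia.
Qed.

Lemma cex_cpow k : cexp (cpow k) = k.
Proof. by rewrite /cexp ex_cpow eqxx mulr1. Qed.

End Cone.

(** * Automorphisms of Out(A) from half transvections *)

Section Automorphisms.
Variables (V : finType) (E : rel V).
Local Notation "u ≈ v" := (raag_eq E u v) (at level 70).
Local Open Scope ring_scope.
Local Notation aut := (is_aut (G := RAAG E)).
Implicit Types a b : (word V -> word V) * (word V -> word V).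

Lemma autP a : aut a <->
  [/\ forall u v, u ≈ v -> a.1 u ≈ a.1 v, forall u v, u ≈ v -> a.2 u ≈ a.2 v,
      forall u v, a.1 (u ++ v) ≈ a.1 u ++ a.1 v, forall u, a.1 (a.2 u) ≈ u
    & forall u, a.2 (a.1 u) ≈ u].
Proof.
split=> [[_ [_ [h1 [h2 [h3 [h4 h5]]]]]] | [h1 h2 h3 h4 h5]]; last by do !split=> //= *; auto.
split=> [u v|u v|u v|u|u]; [exact: h1|exact: h2|exact: h3|exact: h4|exact: h5].
Qed.

Lemma aut_inv a : aut a -> aut (a.2, a.1).
Proof.
case/autP=> h1 h2 h3 h4 h5; apply/autP; split=> //= u v.
transitivity (a.2 (a.1 (a.2 u) ++ a.1 (a.2 v))); first by apply: h2; rewrite !h4.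
by transitivity (a.2 (a.1 (a.2 u ++ a.2 v))); [apply: h2; rewrite h3 | apply: h5].
Qed.

Lemma aut_comp a b : aut a -> aut b -> aut (fun w => a.1 (b.1 w), fun w => b.2 (a.2 w)).
Proof.
case/autP=> h1 h2 h3 h4 h5 /autP[k1 k2 k3 k4 k5]; apply/autP; split=> /=.
- by move=> u v uv; apply/h1/k1.
- by move=> u v uv; apply/k2/h2.
- by move=> u v; rewrite -h3; apply/h1/k3.
- by move=> u; rewrite -[X in _ ≈ X]h4; apply/h1/k4.
- by move=> u; rewrite -[X in _ ≈ X]k5; apply/k2/h5.
Qed.

Lemma aut_nil a : aut a -> a.1 [::] ≈ [::].
Proof.
case/autP=> _ _ h3 _ _; apply: (@cat_raag_eqI _ _ (a.1 [::])).
by rewrite -h3 !cats0.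
Qed.

End Automorphisms.

Section ConeAutomorphisms.
Variables (V : finType) (E : rel V) (c : V).
Hypotheses (Eirr : forall x, ~~ E x x) (Esym : forall x y, E x y = E y x).
Hypothesis Ec : forall v, v != c -> E c v.
Hypothesis Enc : forall v, v != c -> exists2 w, w != v & ~~ E v w.
Local Notation "u ≈ v" := (raag_eq E u v) (at level 70).
Local Open Scope ring_scope.
Local Notation aut := (is_aut (G := RAAG E)).
Local Notation cpow := (cpow c).
Local Notation cex := (cexp c).
Local Notation cpowD := (cpowD E c).
Implicit Types (a b : (word V -> word V) * (word V -> word V)) (phi : V -> int).

Lemma aut_conj_ex phi a b h : (forall w, a.1 w ≈ (h ++ b.1 w) ++ winv h) ->
  forall w, exps phi (a.1 w) = exps phi (b.1 w).
Proof.
move=> H w; rewrite (ex_eq phi (H w)) !ex_cat addrAC -ex_cat (ex_eq phi (cat_winv E h)).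
by rewrite ex_nil add0r.
Qed.

(** Automorphisms preserve the centre, which [c] generates; this is the sign of the action on it. *)
Definition eps a : int := cex (a.1 [:: (c, false)]).

Lemma aut_c a : aut a -> a.1 [:: (c, false)] ≈ cpow (eps a).
Proof.
move=> aut_a; have /autP[h1 h2 h3 h4 h5] := aut_a.
have [|k ak] := center_cone Eirr Esym Ec Enc (z := a.1 [:: (c, false)]).
  move=> x; rewrite -[[:: (x, false)]](cats0 _).
  transitivity (a.1 ([:: (c, false)] ++ a.2 [:: (x, false)])).
    by rewrite h3 h4 cats0.
  have cc := central_cat (a.2 [:: (x, false)]) (c_central Ec).
  by rewrite (h1 _ _ cc) h3 h4 cats0.
by rewrite /eps /cexp (ex_eq _ ak) ex_cpow eqxx mulr1.
Qed.

Lemma aut_cpow a k : aut a -> a.1 (cpow k) ≈ cpow (eps a * k).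
Proof.
move=> aut_a; have /autP[h1 h2 h3 h4 h5] := aut_a.
have S l : a.1 (cpow (l + 1)) ≈ a.1 (cpow l) ++ cpow (eps a).
  by rewrite -(aut_c aut_a) -h3; apply/h1; symmetry; apply: cpowS.
elim/int_rec: k => [|n IH|n IH]; first by rewrite mulr0; apply: aut_nil.
- by rewrite -addn1 PoszD S IH mulrDr mulr1 cpowD.
- apply: (@raag_eq_catI _ _ (cpow (eps a))); rewrite -S -cpowD.
  rewrite (_ : - n.+1%:Z + 1 = - n%:Z); last by lia.
  by rewrite IH (_ : - n%:Z = - n.+1%:Z + 1) ?mulrDr ?mulr1 //; lia.
Qed.

Lemma eps_comp a b : aut a -> aut b ->
  eps (fun w => a.1 (b.1 w), fun w => b.2 (a.2 w)) = eps a * eps b.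
Proof.
move=> aa ab; have /autP[h1 _ _ _ _] := aa.
rewrite {1}/eps /cexp /= (ex_eq _ (h1 _ _ (aut_c ab))) (ex_eq _ (aut_cpow _ aa)).
by rewrite ex_cpow eqxx mulr1.
Qed.

Lemma eps_sign a : aut a -> eps a = 1 \/ eps a = -1.
Proof.
move=> aa; have ai := aut_inv aa; have /autP[_ _ _ h4 _] := aa.
have: eps a * eps (a.2, a.1) = 1.
  rewrite -eps_comp // /eps /= /cexp (ex_eq _ (h4 _)) ex1 /= eqxx //.
move=> /(congr1 absz); rewrite abszM => /eqP; rewrite muln_eq1 => /andP[/eqP e1 _].
by lia.
Qed.

(** Encodes an invariant class in H^1(A; F_2) vanishing on [c], through an integral lift [phi]. *)
Definition aut_even phi := phi c = 0 /\
  forall a, aut a -> forall w, (2 %| exps phi (a.1 w) - exps phi w)%Z.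

Definition shift phi a (w : word V) : int := ((exps phi (a.1 w) - eps a * exps phi w) %/ 2)%Z.

(** The division is exact: [eps a] is odd and [phi] is invariant modulo 2. *)
Lemma shiftE phi a w : aut_even phi -> aut a ->
  shift phi a w * 2 = exps phi (a.1 w) - eps a * exps phi w.
Proof.
move=> [_ he] aa; rewrite /shift divzK //; have := he a aa w.
by case: (eps_sign aa) => ->; rewrite ?mul1r // mulN1r; lia.
Qed.

(* Conjugation of [a] by the half transvection [x |-> x c^(phi x / 2)], which only makes
   sense after adjoining a square root of [c]. *)
Definition twist phi a : (word V -> word V) * (word V -> word V) :=
  (fun w => a.1 w ++ cpow (shift phi a w), fun w => a.2 w ++ cpow (shift phi (a.2, a.1) w)).

Lemma ex_twist phi psi a w : phi c = 0 -> exps phi ((twist psi a).1 w) = exps phi (a.1 w).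
Proof. by move=> p0; rewrite /= ex_cat ex_cpow p0 mulr0 addr0. Qed.

(** The shift sees only exponent sums, which conjugation preserves, and the added power of [c] is
    central. Hence [twist] descends to Out(A). *)
Lemma twist_conj phi a b h : (forall w, a.1 w ≈ (h ++ b.1 w) ++ winv h) ->
  forall w, (twist phi a).1 w ≈ (h ++ (twist phi b).1 w) ++ winv h.
Proof.
move=> H w; rewrite /= {1}H /shift /eps /cexp !(aut_conj_ex _ H).
by rewrite -!catA; do 2!(apply: raag_eq_cat; first reflexivity); symmetry; apply: cpowC.
Qed.

Lemma twist_eq phi a b : (forall w, a.1 w ≈ b.1 w) ->
  forall w, (twist phi a).1 w ≈ (twist phi b).1 w.
Proof.
move=> H w; have := @twist_conj phi a b [::] _ w; rewrite /= /winv /= !cats0; apply.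
by move=> u; rewrite cats0.
Qed.

Lemma twist_comp phi a b : aut_even phi -> aut a -> aut b -> forall w,
  (twist phi (fun w => a.1 (b.1 w), fun w => b.2 (a.2 w))).1 w
  ≈ (twist phi a).1 ((twist phi b).1 w).
Proof.
move=> ev aa ab w; have /autP[h1 _ h3 _ _] := aa.
have hc := aut_comp aa ab.
set ab' := (fun w => a.1 (b.1 w), fun w => b.2 (a.2 w)) in hc *.
change (a.1 (b.1 w) ++ cpow (shift phi ab' w) ≈
  a.1 (b.1 w ++ cpow (shift phi b w)) ++ cpow (shift phi a ((twist phi b).1 w))).
rewrite h3 (aut_cpow _ aa) -catA -cpowD.
(* The cocycle identity for [shift]; after doubling, it telescopes. *)
suff -> : shift phi ab' w =
  eps a * shift phi b w + shift phi a ((twist phi b).1 w) by [].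
have p0 : phi c = 0 by case: ev.
apply: (@mulIf _ 2) => //; rewrite mulrDl -mulrA !shiftE // eps_comp //= ex_twist //.
have -> : exps phi (a.1 (b.1 w ++ cpow (shift phi b w))) = exps phi (a.1 (b.1 w)).
  rewrite (ex_eq phi (h3 _ _)) ex_cat (ex_eq phi (aut_cpow _ aa)) ex_cpow p0.
  by rewrite mulr0 addr0.
by ring.
Qed.

Lemma twist_id phi w : (twist phi (id, id)).1 w = w.
Proof. by rewrite /= /shift /eps /cexp ex1 eqxx !mul1r subrr div0z cats0. Qed.

Lemma twist_aut phi a : aut_even phi -> aut a -> aut (twist phi a).
Proof.
move=> ev aa; have ai := aut_inv aa.
have R b : aut b -> forall u v, u ≈ v -> (twist phi b).1 u ≈ (twist phi b).1 v.
  case/autP=> h1 _ _ _ _ u v uv /=.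
  by rewrite /shift (ex_eq phi (h1 _ _ uv)) (ex_eq phi uv) (h1 _ _ uv).
have K b : aut b -> forall u, (twist phi b).1 ((twist phi (b.2, b.1)).1 u) ≈ u.
  move=> ab u; have bi := aut_inv ab; rewrite -(twist_comp ev ab bi) /=.
  rewrite -[X in _ ≈ X](twist_id phi); apply: twist_eq => v /=.
  by case/autP: ab.
apply/autP; split.
- exact: R.
- exact: (R _ ai).
- move=> u v; have /autP[_ _ h3 _ _] := aa.
  have -> : (twist phi a).1 (u ++ v) = a.1 (u ++ v) ++ cpow (shift phi a u + shift phi a v).
    congr (_ ++ cpow _); apply: (@mulIf _ 2) => //.
    by rewrite mulrDl !shiftE // (ex_eq phi (h3 _ _)) !ex_cat; ring.
  rewrite h3 cpowD /= -!catA; apply: raag_eq_cat => //.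
  by rewrite !catA; apply: raag_eq_cat => //; symmetry; apply: cpowC.
- exact: K.
- by move=> u; apply: (K _ ai).
Qed.

Lemma aut_evenN phi : aut_even phi -> aut_even (fun x => - phi x).
Proof.
case=> p0 he; split=> [|a aa w]; first by rewrite p0 oppr0.
by rewrite !ex_opp; have := he a aa w; lia.
Qed.

(** The two shifts cancel. Asking for [psi = - phi] only pointwise covers both orders of
    composition, since negating [phi] twice gives it back only pointwise. *)
Lemma twistK phi psi a : aut_even phi -> aut_even psi -> (forall x, psi x = - phi x) -> aut a ->
  forall w, (twist psi (twist phi a)).1 w ≈ a.1 w.
Proof.
move=> ev ev' pN aa w; have ta := twist_aut ev aa.
change ((a.1 w ++ cpow (shift phi a w)) ++ cpow (shift psi (twist phi a) w) ≈ a.1 w).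
rewrite -catA -cpowD.
suff -> : shift phi a w + shift psi (twist phi a) w = 0 by rewrite cats0.
have exN u : exps psi u = - exps phi u.
  by rewrite -ex_opp; apply: eq_bigr => p _; rewrite pN.
have ee : eps (twist phi a) = eps a.
  rewrite {1}/eps /cexp /= ex_cat ex_cpow eqxx mulr1.
  suff -> : shift phi a [:: (c, false)] = 0 by rewrite addr0.
  apply: (@mulIf _ 2) => //; rewrite mul0r shiftE // (ex_eq phi (aut_c aa)) ex_cpow ex1.
  by case: ev => ->  _; rewrite !mulr0 subrr.
apply: (@mulIf _ 2) => //; rewrite mul0r mulrDl !shiftE // ee !exN ex_twist; last by case: ev.
by ring.
Qed.

Lemma twist_out_aut phi : aut_even phi ->
  is_aut (G := Out (RAAG E)) (twist phi, twist (fun x => - phi x)).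
Proof.
move=> ev; have ev' := aut_evenN ev.
have one a b : (forall w, a.1 w ≈ b.1 w) -> Defs.geq (Out (RAAG E)) a b.
  by move=> H; exists [::]; split=> // w _; rewrite /= cats0.
have R psi a b : Defs.geq (Out (RAAG E)) a b -> Defs.geq (Out (RAAG E)) (twist psi a) (twist psi b).
  case=> h [_ H]; exists h; split=> // w _.
  by apply: twist_conj => {w} w; apply: H.
split; first by move=> a /= aa; apply: twist_aut.
split; first by move=> a /= aa; apply: twist_aut.
split; first by move=> a b _ _; apply: R.
split; first by move=> a b _ _; apply: R.
split; first by move=> a b aa ab; apply: one => w; apply: twist_comp.
split=> a aa; apply: one => w; last exact: twistK.
by apply: twistK => // x; rewrite opprK.
Qed.

End ConeAutomorphisms.

(** * Separating twists modulo inner automorphisms *)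

Section Distinct.
Variables (V : finType) (E : rel V) (c : V).
Hypotheses (Eirr : forall x, ~~ E x x) (Esym : forall x y, E x y = E y x).
Hypothesis Ec : forall v, v != c -> E c v.
Hypothesis Enc : forall v, v != c -> exists2 w, w != v & ~~ E v w.
Local Notation "u ≈ v" := (raag_eq E u v) (at level 70).
Local Open Scope ring_scope.
Local Notation aut := (is_aut (G := RAAG E)).
Local Notation cpow := (cpow c).
Local Notation cex := (cexp c).

(* The automorphism inverting [c] and fixing every other generator. *)
Definition cflip (w : word V) : word V := w ++ cpow (- (2 * cex w)).

Lemma cex_cflip w : cex (cflip w) = - cex w.
Proof. by rewrite /cflip /cexp ex_cat ex_cpow eqxx mulr1 -/(cex w); ring. Qed.

Lemma cflip_aut : aut (cflip, cflip).
Proof.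
have R u v : u ≈ v -> cflip u ≈ cflip v.
  by move=> uv; rewrite /cflip /cexp (ex_eq _ uv) uv.
have K u : cflip (cflip u) ≈ u.
  rewrite {1}/cflip cex_cflip /cflip -catA -cpowD.
  by rewrite (_ : _ + _ = 0) ?cats0 //; ring.
apply/autP; split=> //= u v.
rewrite /cflip {1}/cexp ex_cat mulrDr opprD cpowD -!catA; apply: raag_eq_cat => //.
by rewrite !catA; apply: raag_eq_cat => //; symmetry; apply: cpowC.
Qed.

Lemma eps_cflip : eps c (cflip, cflip) = -1.
Proof. by rewrite /eps /= -/(cex _) cex_cflip /cexp ex1 eqxx. Qed.

(** As [eps] is -1 here, the numerator is twice [exps phi w], so [phi] itself can be read off from
    the twist of [cflip]. *)
Lemma shift_cflip phi w : phi c = 0 -> shift c phi (cflip, cflip) w = exps phi w.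
Proof.
move=> p0; rewrite /shift eps_cflip /= ex_cat ex_cpow p0 mulr0 addr0.
by rewrite (_ : _ - _ = exps phi w * 2) ?mulzK //; ring.
Qed.

(* Compare the [c]-exponents modulo 2 of both sides at the automorphism [cflip]. *)
Lemma twist_out_neq phi psi x : aut_even E c phi -> aut_even E c psi ->
  ~~ (2 %| phi x - psi x)%Z ->
  ~ Defs.geq (Out (Out (RAAG E))) (twist c phi, twist c (fun v => - phi v))
                                  (twist c psi, twist c (fun v => - psi v)).
Proof.
move=> [p0 _] evs ne [h [/= aut_h /(_ (cflip, cflip) cflip_aut) [g [_ H]]]].
have s0 : psi c = 0 by case: evs.
pose w : word V := [:: (x, false)].
pose u := h.2 w.
(* Exponent sums do not see the conjugation by [g]. *)
have := @aut_conj_ex _ E (fun v => (v == c)%:R) (twist c phi (cflip, cflip))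
  (fun w => h.1 ((twist c psi (cflip, cflip)).1 (h.2 w)), id) g (fun w => H w I) w.
have /autP[h1 _ h3 h4 _] := aut_h.
change (cex (cflip w ++ cpow (shift c phi (cflip, cflip) w)) =
  cex (h.1 (cflip u ++ cpow (shift c psi (cflip, cflip) u))) -> False).
have cexD u1 u2 : cex (u1 ++ u2) = cex u1 + cex u2 by exact: ex_cat.
have cexE u1 u2 : u1 ≈ u2 -> cex u1 = cex u2 by exact: ex_eq.
rewrite !shift_cflip // cexD cex_cflip cex_cpow (cexE _ _ (h3 _ _)) cexD.
rewrite (cexE _ _ (h3 _ _)) cexD !(cexE _ _ (aut_cpow Eirr Esym Ec Enc _ aut_h)) !cex_cpow.
rewrite (cexE _ _ (h4 w)).
(* Modulo 2 the equation reads [phi x = exps psi u], and [psi] has the same parity at [u] as at [w]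
   by invariance under the inverse of [h]. *)
case: evs => _ /(_ _ (aut_inv aut_h) w) /=; rewrite -/u.
have -> : exps phi w = phi x by rewrite /w ex1 mul1r.
have -> : exps psi w = psi x by rewrite /w ex1 mul1r.
by case: (eps_sign Eirr Esym Ec Enc aut_h) => ->; lia.
Qed.

End Distinct.

(** * Invariant classes modulo 2 *)

Section Parity.
Variables (V : finType) (E : rel V).
Local Notation "u ≈ v" := (raag_eq E u v) (at level 70).
Local Notation aut := (is_aut (G := RAAG E)).
Implicit Types (F : V -> bool) (S T : {set V}).

(** The homomorphism to F_2 with values [F] on the generators; [par (mem S)] is the class of [S] in
    H^1(A; F_2). *)
Definition par F (w : word V) : bool := \big[addb/false]_(p <- w) F p.1.

Lemma par1 F x b : par F [:: (x, b)] = F x. Proof. exact: big_seq1. Qed.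

Lemma par_cat F u v : par F (u ++ v) = par F u (+) par F v. Proof. exact: big_cat. Qed.

Lemma par_eq F u v : u ≈ v -> par F u = par F v.
Proof.
apply: eval_raag_eq => [x b|x y _] /=; first exact: addbb.
exact: addbC.
Qed.

Lemma par_ex F w : (2 %| (exps (fun v => (F v : nat)%:Z) w - (par F w : nat)%:Z)%R)%Z.
Proof.
elim: w => [|[x b] w IH]; first by rewrite /exps /par !big_nil.
move: IH; rewrite -cat1s ex_cat par_cat par1 ex1.
by case: (F x); case: (par F w); case: b; rewrite /sgb /=; lia.
Qed.

(** The induced map on H^1(A; F_2), a class being encoded by the set of generators where it is 1. *)
Definition pull (a : (word V -> word V) * (word V -> word V)) S : {set V} :=
  [set v | par (mem S) (a.1 [:: (v, false)])].

Lemma in_pull a S v : (v \in pull a S) = par (mem S) (a.1 [:: (v, false)]).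
Proof. by rewrite in_set. Qed.

Lemma par_pull a S w : aut a -> par (mem (pull a S)) w = par (mem S) (a.1 w).
Proof.
move=> aa; have /autP[h1 _ h3 _ _] := aa; elim: w => [|[x b] w IH].
  by rewrite (par_eq _ (aut_nil aa)) /par !big_nil.
rewrite -cat1s par_cat (par_eq _ (h3 _ _)) par_cat IH par1; congr (_ (+) _).
rewrite [LHS]in_pull; case: b => //.
have := par_eq (mem S) (h1 _ _ (cat_letterV E x false)).
rewrite (par_eq _ (h3 _ _)) par_cat (par_eq _ (aut_nil aa)).
by rewrite [RHS]big_nil /=; case: (par _ _); case: (par _ _).
Qed.

Lemma pullK a S : aut a -> pull (a.2, a.1) (pull a S) = S.
Proof.
move=> aa; have /autP[_ _ _ h4 _] := aa.
by apply/setP=> v; rewrite in_pull par_pull //= (par_eq _ (h4 _)) par1.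
Qed.

Lemma pull_inj a : aut a -> injective (pull a).
Proof. by move=> aa; apply: (can_inj (g := pull (a.2, a.1))) => S; apply: pullK. Qed.

(** Vanishing of the cup product: H^2(A; F_2) has one coordinate per edge, and on the edge xy the
    product of S and T is S(x)T(y) + S(y)T(x). *)
Definition perp S T :=
  [forall x, forall y, E x y ==> ((x \in S) && (y \in T) == (y \in S) && (x \in T))].

Lemma perpP S T : reflect
  (forall x y, E x y -> (x \in S) && (y \in T) = (y \in S) && (x \in T)) (perp S T).
Proof.
apply: (iffP forallP) => [h x y Exy|h x].
  by move/forallP/(_ y)/implyP/(_ Exy)/eqP: (h x).
by apply/forallP=> y; apply/implyP=> /h->.
Qed.

End Parity.

(* The mod-2 Heisenberg group: [(a, b, z)] is the unitriangular matrix with entries [a], [b]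
   next to the diagonal and [z] in the corner. *)
Definition heis_mul (g h : bool * bool * bool) : bool * bool * bool :=
  (g.1.1 (+) h.1.1, g.1.2 (+) h.1.2, g.2 (+) h.2 (+) (g.1.1 && h.1.2)).
Definition heis_one : bool * bool * bool := (false, false, false).

Fact heis_mulA : associative heis_mul. Proof. by do 3!move=> [[[] []] []]. Qed.
Fact heis_mul1 : left_id heis_one heis_mul. Proof. by move=> [[[] []] []]. Qed.
Fact heis_1mul : right_id heis_one heis_mul. Proof. by move=> [[[] []] []]. Qed.
HB.instance Definition _ :=
  Monoid.isLaw.Build (bool * bool * bool)%type heis_one heis_mul heis_mulA heis_mul1 heis_1mul.

(* [perp S T] says exactly that the homomorphism (par S, par T) lifts to the Heisenberg group,
   a property preserved by composition with automorphisms. *)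
Lemma perp_pull (V : finType) (E : rel V) a (S T : {set V}) : is_aut (G := RAAG E) a ->
  perp E S T -> perp E (pull a S) (pull a T).
Proof.
move=> aa /perpP ST; have /autP[h1 _ h3 _ _] := aa.
(* The inverse of (s, t, 0) in the Heisenberg group has corner entry st. *)
pose l (p : V * bool) := (p.1 \in S, p.1 \in T, [&& p.2, p.1 \in S & p.1 \in T]).
pose H w := \big[heis_mul/heis_one]_(p <- w) l p.
have H_eq u v : raag_eq E u v -> H u = H v.
  apply: eval_raag_eq => [x b|x y Exy]; rewrite /l /=.
    by case: b; case: (x \in S); case: (x \in T).
  move: (ST x y Exy); rewrite /heis_mul /= => ->.
  by rewrite (addbC (x \in S)) (addbC (x \in T)).
have H_cat u v : H (u ++ v) = heis_mul (H u) (H v) by exact: big_cat.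
have H1 w : (H w).1 = (par (mem S) w, par (mem T) w).
  elim: w => [|p w IH]; first by rewrite /H /par !big_nil.
  by rewrite /H /par !big_cons /= -/(H w) IH.
apply/perpP=> x y Exy; rewrite !in_pull.
have /h1/H_eq := commute_edge false false Exy.
rewrite !(H_eq _ _ (h3 _ _)) !H_cat /heis_mul !H1 /=.
(* The products in both orders have equal corners; cancelling the corners of the factors leaves the
   equation of [perp]. *)
by case=> _ _; case: (H _).2; case: (H _).2; do 4!case: (par _ _).
Qed.

(** * Counting orthogonal classes in a cone *)

Section Invariants.
Variables (V : finType) (E : rel V) (c : V).
Hypotheses (Eirr : forall x, ~~ E x x) (Esym : forall x y, E x y = E y x).
Hypothesis Ec : forall v, v != c -> E c v.
Hypothesis Enc : forall v, v != c -> exists2 w, w != v & ~~ E v w.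
Local Notation aut := (is_aut (G := RAAG E)).
Implicit Types (S T : {set V}) (x y v w : V).

Definition perps S := [set T | perp E S T & c \notin T].

(** An automorphism maps [c] to a power of [c], so a class vanishing at [c] pulls back to another
    such class; the converse uses the inverse automorphism. *)
Lemma pull_cone a S : aut a -> (c \in pull a S) = (c \in S).
Proof.
have side b T : aut b -> c \notin T -> c \notin pull b T.
  move=> ab nT; rewrite in_pull (par_eq _ (aut_c Eirr Esym Ec Enc ab)).
  rewrite /par /cpow; elim: absz => [|n IH]; rewrite ?big_nil // big_cons /=.
  by rewrite (negbTE nT).
move=> aa; apply/idP/idP; first by apply: contraLR; apply: side.
by apply: contraLR => /(side _ _ (aut_inv aa)); rewrite pullK.
Qed.

Lemma card_perps_pull a S : aut a -> #|perps (pull a S)| = #|perps S|.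
Proof.
have le b T : aut b -> #|perps T| <= #|perps (pull b T)|.
  move=> ab; rewrite -(card_imset _ (pull_inj ab)); apply/subset_leq_card/subsetP.
  by move=> _ /imsetP[U /[!inE] /andP[pU nU] ->]; rewrite perp_pull ?pull_cone.
move=> aa; apply/eqP; rewrite eqn_leq le // andbT.
by rewrite -{2}(pullK S aa) le //; apply: aut_inv.
Qed.

(** The count is the one attained by [[set v]] for [v] of degree [d] in the base graph: orthogonal
    classes avoid [c] and the [d] neighbours. *)
Definition sized d S := (c \notin S) && (#|perps S| == 2 ^ (#|V| - d.+1)).

Lemma sized_pull a d S : aut a -> sized d (pull a S) = sized d S.
Proof. by move=> aa; rewrite /sized (pull_cone S aa) (card_perps_pull S aa). Qed.

Definition sized_sum d v := \big[addb/false]_(S | sized d S) (v \in S).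

Lemma par_sized_sum d (w : word V) : par (sized_sum d) w = \big[addb/false]_(S | sized d S) par (mem S) w.
Proof. by rewrite /par exchange_big. Qed.

(** Pulling back permutes the sized classes, so their sum in F_2 is fixed; it vanishes on [c]
    because each of them does. *)
Lemma sized_sum_even d : aut_even E c (fun v => (sized_sum d v : nat)%:Z%R).
Proof.
split; first by rewrite /sized_sum big1 // => S /andP[/negbTE].
move=> a aa w; have : par (sized_sum d) (a.1 w) = par (sized_sum d) w.
  rewrite !par_sized_sum [RHS](reindex_inj (pull_inj aa)).
  by apply: eq_big => [S|S _]; rewrite ?(sized_pull _ _ aa) ?(par_pull _ _ aa).
move=> e; have := par_ex (sized_sum d) (a.1 w); have := par_ex (sized_sum d) w.
by rewrite e; lia.
Qed.

Definition nbrs v := [set w | E v w & w != c].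

Lemma card_subset_setC S : #|powerset (~: S)| = 2 ^ (#|V| - #|S|).
Proof. by rewrite card_powerset cardsCs setCK. Qed.

Lemma card_nbrs v : #|nbrs v| < #|V|.
Proof.
by rewrite -[X in _ < X]cardsT proper_card // properEneq subsetT andbT;
  apply/eqP=> /setP/(_ c); rewrite !inE eqxx andbF.
Qed.

Lemma card_perps1 v : v != c -> #|perps [set v]| = 2 ^ (#|V| - #|nbrs v|.+1).
Proof.
move=> nvc; have -> : #|nbrs v|.+1 = #|c |: nbrs v| by rewrite cardsU1 !inE eqxx andbF.
rewrite -card_subset_setC; apply: eq_card => T; rewrite !inE; apply/andP/subsetP.
  move=> [/perpP h nT] x xT; rewrite !inE negb_or negb_and.
  have nxc : x != c by apply: contraNneq nT => <-.
  rewrite nxc orbF /=; apply/negP=> Evx; have := h v x Evx.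
  rewrite !inE eqxx xT /=; case: eqP => // xv; by move: (Eirr v); rewrite -{2}xv Evx.
move=> h; have nT : c \notin T by apply/negP=> /h; rewrite !inE eqxx.
split=> //; apply/perpP=> x y Exy; rewrite !inE.
have key u z : E u z -> (u == v) && (z \in T) = false.
  move=> Euz; apply/negP=> /andP[/eqP uv zT]; have := h z zT.
  by rewrite !inE -uv Euz /= negb_or negbK => /andP[zc /eqP zc']; rewrite zc' eqxx in zc.
by rewrite !key // Esym.
Qed.

(** Since [v] and [w] lie in [S], orthogonality determines [T] at their neighbours from its values
    at [v] and [w]. So [T] is determined by its part outside the set in the exponent, from which [v]
    is removed to keep the value there available. *)
Lemma card_perps2 S v w : c \notin S -> v \in S -> w \in S -> v != w ->
  #|perps S| <= 2 ^ (#|V| - #|(nbrs v :|: nbrs w) :\ v|.+1).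
Proof.
move=> nS vS wS nvw; set D := _ :\ v.
have nD : c \notin D by rewrite !inE eqxx !andbF.
have -> : #|D|.+1 = #|c |: D| by rewrite cardsU1 nD.
rewrite -card_subset_setC.
have nvc : v != c by apply: contraNneq nS => <-.
have nwc : w != c by apply: contraNneq nS => <-.
have inj : {in perps S &, injective (fun T => T :\: D)}.
  move=> T T'; rewrite !inE => /andP[/perpP hT nT] /andP[/perpP hT' nT'] /setP TT'.
  have off u : u \notin D -> (u \in T) = (u \in T').
    by move=> uD; have := TT' u; rewrite in_setD uD in_setD uD.
  have vTT : (v \in T) = (v \in T') by apply: off; rewrite !inE eqxx.
  have wTT : (w \in T) = (w \in T').
    (* If [v] and [w] are adjacent then [w] is in [D], but orthogonality on that edge gives [T] the
       same value at both ends. *)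
    case Evw: (E v w); last by apply: off; rewrite !inE Evw (negbTE (Eirr w)) /= andbF.
    by have := hT _ _ Evw; have := hT' _ _ Evw; rewrite vS wS /= => -> ->.
  apply/setP=> u; have [uD|] := boolP (u \in D); last exact: off.
  move: uD; rewrite !inE => /andP[_ /orP[] /andP[Eu _]].
    by have := hT _ _ Eu; have := hT' _ _ Eu; rewrite vS vTT /= => -> ->.
  by have := hT _ _ Eu; have := hT' _ _ Eu; rewrite wS wTT /= => -> ->.
rewrite -(card_in_imset inj); apply/subset_leq_card/subsetP => _ /imsetP[T + ->].
rewrite !inE => /andP[_ nT]; apply/subsetP=> u; rewrite in_setD => /andP[uD uT].
rewrite in_setC in_setU1 negb_or uD andbT; by apply: contraNneq nT => <-.
Qed.

Variable M : nat.
Hypothesis deg_le : forall v, v != c -> #|nbrs v| <= M.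
Hypothesis deg2_gt : forall v w, v != c -> w != c -> v != w ->
  M < #|(nbrs v :|: nbrs w) :\ v|.
Hypothesis card_gtM : M < #|V|.

(** The empty set has too many orthogonal classes, as [d > 0], and a set with two elements too few,
    by [deg2_gt]. *)
Lemma sized_singleton d S : 0 < d <= M -> sized d S ->
  exists v, [/\ v != c, #|nbrs v| = d & S = [set v]].
Proof.
move=> /andP[d0 dM] /andP[nS /eqP cS].
have [S0|[v vS]] := set_0Vmem S.
  have : #|perps S| = 2 ^ (#|V| - #|[set c]|).
    rewrite -card_subset_setC S0; apply: eq_card => T.
    rewrite inE [RHS]inE subsetC sub1set in_setC andbC.
    by case: (c \notin T) => //=; apply/perpP=> x y _; rewrite !inE.
  by rewrite cS cards1 => /eqP; rewrite eqn_exp2l // => /eqP; lia.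
have nvc : v != c by apply: contraNneq nS => <-.
have [S1|] := eqVneq S [set v].
  exists v; split=> //; move: cS; rewrite S1 card_perps1 // => /eqP.
  by rewrite eqn_exp2l // => /eqP; have := card_nbrs v; have := deg_le nvc; lia.
rewrite eqEsubset sub1set vS andbT => /subsetPn[w wS]; rewrite inE => nwv.
have nvw : v != w by rewrite eq_sym.
have nwc : w != c by apply: contraNneq nS => <-.
have := card_perps2 nS vS wS nvw; rewrite cS leq_exp2l //.
have := deg2_gt nvc nwc nvw; set D := _ :\ v => MD.
(* Subtraction is truncated, so this bound is what makes the two exponents differ. *)
suff : #|D| < #|V| by lia.
by rewrite -[X in _ < X]cardsT proper_card // properT; apply/eqP=> /setP/(_ v); rewrite !inE eqxx.
Qed.

Lemma sized_sum1 d v : 0 < d <= M -> v != c -> sized_sum d v = (#|nbrs v| == d).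
Proof.
move=> dM nvc.
have vN S : sized d S -> S != [set v] -> (v \in S) = false.
  move=> /(sized_singleton dM)[u [_ _ ->]] nuv.
  by rewrite inE; apply: contraNF nuv => /eqP->.
have [dv|ndv] := eqVneq #|nbrs v| d; last first.
  rewrite /sized_sum big1 // => S sS; apply: vN => //; apply: contraNneq ndv => Sv.
  have [u [_ <-]] := sized_singleton dM sS.
  by rewrite Sv => /set1_inj->.
rewrite /sized_sum (bigD1 [set v]) /=; last first.
  by rewrite /sized card_perps1 // dv eqxx inE eq_sym nvc.
by rewrite inE eqxx big1 // => S /andP[sS]; apply: vN.
Qed.

End Invariants.

(** * Cones over disjoint cubes *)

Section Cubes.
Variables (m : nat).
Implicit Types x y z : {ffun 'I_m -> bool}.

Definition flip (a : 'I_m) x : {ffun 'I_m -> bool} := [ffun b => x b (+) (b == a)].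

Lemma flipK a : involutive (flip a).
Proof. by move=> x; apply/ffunP=> b; rewrite !ffunE -addbA addbb addbF. Qed.

Lemma flip_inj x : injective (flip^~ x).
Proof.
move=> a b /ffunP/(_ a); rewrite !ffunE eqxx.
by case: eqP => // _; case: (x a).
Qed.

Lemma flip_neq a x : flip a x != x.
Proof. by apply/eqP=> /ffunP/(_ a); rewrite ffunE eqxx; case: (x a). Qed.

Lemma flip_eq_or a b d x y : x d != y d -> flip a x = flip b y -> a = d \/ b = d.
Proof.
move=> xy /ffunP/(_ d); rewrite !ffunE.
have [->|_] := eqVneq d a; first by left.
have [->|_] := eqVneq d b; first by right.
by rewrite !addbF => e; rewrite e eqxx in xy.
Qed.

(** Only the first [n] coordinates may change, so for n at most m this is a disjoint union of
    n-cubes on a vertex type that does not depend on [n]. *)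
Definition cube_adj n x y := [exists a : 'I_m, (a < n) && (y == flip a x)].

Lemma cube_adj_sym n x y : cube_adj n x y = cube_adj n y x.
Proof.
suff h u v : cube_adj n u v -> cube_adj n v u by apply/idP/idP; apply: h.
by case/existsP=> a /andP[an /eqP->]; apply/existsP; exists a; rewrite an flipK /=.
Qed.

Lemma card_cube_adj n x : n <= m -> #|[set y | cube_adj n x y]| = n.
Proof.
move=> nm; rewrite -[RHS]card_ord.
have inj : injective (fun a : 'I_n => flip (widen_ord nm a) x).
  by move=> a b /flip_inj/(congr1 val) /= ab; apply: val_inj.
rewrite -(card_codom inj); apply: eq_card => y; rewrite inE; apply/existsP/codomP.
  by move=> [a /andP[an /eqP->]]; exists (Ordinal an); congr flip; apply: val_inj.
by case=> a ->; exists (widen_ord nm a); apply/andP; split; [exact: (ltn_ord (a : 'I_n)) | exact: eqxx].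
Qed.

(** At a coordinate [d] where [x] and [y] differ, a common neighbour agrees with only one of them,
    so it is [flip d x] or [flip d y]. *)
Lemma card_cube_adjI n n' x y : x != y ->
  #|[set z | cube_adj n x z] :&: [set z | cube_adj n' y z]| <= 2.
Proof.
move=> nxy; have [d xy] : exists d, x d != y d.
  by apply/existsP; apply: contraNT nxy => /existsPn h; apply/eqP/ffunP=> d; apply/eqP/negPn/h.
apply: leq_trans (_ : #|[set flip d x; flip d y]| <= 2); last by rewrite cards2; case: eqP.
apply/subset_leq_card/subsetP => z; rewrite !inE.
case/andP=> /existsP[a /andP[_ /eqP->]] /existsP[b /andP[_ /eqP e]].
by case: (flip_eq_or xy e) => ed; subst d; rewrite ?e eqxx ?orbT.
Qed.

End Cubes.

Section ConeCubes.
Variable N : nat.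
Local Notation m := (2 * N + 4).
Local Notation cubes := ('I_N.+1 * {ffun 'I_m -> bool})%type.

(* The cone, with apex [None], over disjoint cubes: the [i]-th component is made of copies of
   the cube of dimension [N + 4 + i]. *)
Definition cone_cubes (u v : option cubes) : bool :=
  match u, v with
  | Some p, Some q => (p.1 == q.1) && cube_adj (N + 4 + p.1) p.2 q.2
  | None, None => false
  | _, _ => true
  end.

Lemma cone_cubes_irr u : ~~ cone_cubes u u.
Proof.
case: u => [[i x]|] //=; rewrite eqxx /=; apply/existsPn=> a.
by rewrite negb_and eq_sym flip_neq orbT.
Qed.

Lemma cone_cubes_sym u v : cone_cubes u v = cone_cubes v u.
Proof.
case: u v => [[i x]|] [[j y]|] //=; rewrite eq_sym.
by case: eqP => //= ->; apply: cube_adj_sym.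
Qed.

Local Notation nbrs := (nbrs cone_cubes None).

Lemma nbrs_cubes i x :
  nbrs (Some (i, x)) = (fun y => Some (i, y)) @: [set y | cube_adj (N + 4 + i) x y].
Proof.
apply/setP=> -[[j y]|]; rewrite !inE /=; last by apply/esym/imsetP=> -[].
rewrite andbT; apply/andP/imsetP=> [[/eqP<- xy]|[z /[!inE] xz [-> ->]]] //.
by exists y; rewrite ?inE.
Qed.

Lemma card_nbrs_cubes i x : #|nbrs (Some (i, x))| = N + 4 + i.
Proof.
rewrite nbrs_cubes card_imset; last by move=> y z [].
by rewrite card_cube_adj //; have := ltn_ord i; lia.
Qed.

Lemma card_nbrs_cubesI u v : u != v -> u != None -> v != None -> #|nbrs u :&: nbrs v| <= 2.
Proof.
case: u v => [[i x]|] [[j y]|] // nuv _ _; rewrite !nbrs_cubes.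
have [ij|nij] := eqVneq i j.
  subst j; rewrite -imsetI; last by move=> ? ? _ _ [].
  rewrite card_imset; last by move=> ? ? [].
  by apply: card_cube_adjI; apply: contraNneq nuv => ->.
apply: leq_trans (_ : #|set0 : {set option cubes}| <= 2); last by rewrite cards0.
apply/subset_leq_card/subsetP => z; rewrite inE => /andP[/imsetP[y1 _ ->] /imsetP[y2 _ [ij _]]].
by rewrite ij eqxx in nij.
Qed.

Lemma card_nbrs_cubes_le v : v != None -> #|nbrs v| <= m.
Proof. by case: v => [[i x]|] // _; rewrite card_nbrs_cubes; have := ltn_ord i; lia. Qed.

(** Each vertex has at least N + 4 neighbours, two vertices share at most 2, and removing [v] costs
    at most 1, which leaves 2N + 5. This is why the dimensions start at N + 4. *)
Lemma card_nbrs_cubes2 v w : v != None -> w != None -> v != w ->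
  m < #|(nbrs v :|: nbrs w) :\ v|.
Proof.
move=> nv nw nvw; have := card_nbrs_cubesI nvw nv nw.
have := cardsU (nbrs v) (nbrs w); have := cardsD1 v (nbrs v :|: nbrs w).
case: v w {nvw} nv nw => [[i x]|] // [[j y]|] // _ _; rewrite !card_nbrs_cubes.
by move=> e1 e2; lia.
Qed.

Lemma card_cubes_gt : m + 2 < #|{: option cubes}|.
Proof.
rewrite card_option card_prod card_ffun card_bool !card_ord.
have := @ltn_expl 2 (2 * N + 3) isT.
rewrite (_ : m = (2 * N + 3).+1) ?expnS; last by lia.
by move: (2 ^ _) => k; nia.
Qed.

Lemma cone_cubes_apex v : v != None -> cone_cubes None v.
Proof. by case: v. Qed.

(** The vertex [v], the apex and the neighbours of [v] number at most m + 2, fewer than all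
    vertices. *)
Lemma cone_cubes_nonadj v : v != None -> exists2 w, w != v & ~~ cone_cubes v w.
Proof.
move=> nv; case: (pickP [predC v |: (None |: nbrs v)]) => [w|h].
  rewrite !inE !negb_or negb_and negbK => /and3P[nwv nwc].
  by rewrite (negbTE nwc) orbF => nvw; exists w.
have : #|{: option cubes}| <= #|v |: (None |: nbrs v)|.
  by apply/subset_leq_card/subsetP=> w _; have /negbFE := h w.
have := card_cubes_gt; have := card_nbrs_cubes_le nv.
have := cardsU1 v (None |: nbrs v); have := cardsU1 None (nbrs v).
by case: (v \in _); case: (None \in _); lia.
Qed.

End ConeCubes.

Theorem theoremB : forall N : nat,
  exists (V : finType) (E : rel V),
    simplicial E /\ card_gt (Out (Out (RAAG E))) N.
Proof.
move=> N; exists (option ('I_N.+1 * {ffun 'I_(2 * N + 4) -> bool})), (@cone_cubes N).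
have irr := @cone_cubes_irr N; have sym := @cone_cubes_sym N.
have apex := @cone_cubes_apex N; have nonadj := @cone_cubes_nonadj N.
split=> //.
(* One invariant class per cube dimension N + 4 + i. *)
pose phi (i : 'I_N.+1) v : int := (sized_sum (@cone_cubes N) None (N + 4 + i) v : nat)%:Z%R.
have ev i : aut_even (@cone_cubes N) None (phi i) by apply: sized_sum_even.
exists (fun i => (twist None (phi i), twist None (fun v => - phi i v)%R)); split.
  by move=> i; apply: twist_out_aut.
(* The chosen vertex of the i-th component has degree N + 4 + i, so [phi i] is 1 there and [phi j]
   is 0. *)
move=> i j nij; apply: (twist_out_neq irr sym apex nonadj (x := Some (i, [ffun => false]))) => //.
have gtM : 2 * N + 4 < #|{: option ('I_N.+1 * {ffun 'I_(2 * N + 4) -> bool})}|.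
  by have := card_cubes_gt N; lia.
have lt (k : 'I_N.+1) : 0 < N + 4 + k <= 2 * N + 4 by have := ltn_ord k; lia.
rewrite /phi !(sized_sum1 irr sym (@card_nbrs_cubes_le N) (@card_nbrs_cubes2 N) gtM) //.
rewrite card_nbrs_cubes eqxx eqn_add2l; move: nij; rewrite -val_eqE /=.
by case: eqP.
Qed.
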